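(* Let $F$ be a field of characteristic zero. If $A$ is a finite dimensional unitary $F$-algebra with trace, then the sequence $c_n^{tr}(A)$, $n=1,2,\dots$, is either polynomially bounded or grows exponentially.
   Context: $F$ is a field of characteristic 0. An algebra with trace is a unitary associative $F$-algebra $A$ with an $F$-linear map $\mathrm{tr}:A\to F$ such that $\mathrm{tr}(ab)=\mathrm{tr}(ba)$; a scalar is identified with the corresponding multiple of $1_A$. The free algebra with trace $F\langle X,\mathrm{Tr}\rangle\cong F\langle X\rangle\otimes F[\mathrm{Tr}(M)]$ on $X=\{x_1,x_2,\dots\}$ is generated by the free unitary associative algebra $F\langle X\rangle$ and central commuting indeterminates $\mathrm{Tr}(M)$, $M$ a nonempty word in $X$, subject to $\mathrm{Tr}(MN)=\mathrm{Tr}(NM)$ and $\mathrm{Tr}(\mathrm{Tr}(M)N)=\mathrm{Tr}(M)\mathrm{Tr}(N)$. An element is a trace identity of $A$ if it becomes $0$ whenever the variables are replaced by arbitrary elements of $A$ and $\mathrm{Tr}$ by $\mathrm{tr}$; $\mathrm{Id}^{tr}(A)$ is the set of trace identities of $A$. $MT_n$ is the space of multilinear elements of $F\langle X,\mathrm{Tr}\rangle$ in $x_1,\dots,x_n$ (the span of all products of traces of words times a word in which each of $x_1,\dots,x_n$ occurs exactly once in total), and $c_n^{tr}(A)=\dim_F MT_n/(MT_n\cap \mathrm{Id}^{tr}(A))$. Polynomially bounded means bounded above by a polynomial in $n$; growing exponentially means $c_n^{tr}(A)\ge C b^n$ for all $n\geq 1$, for some $C>0$, $b>1$. *)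

(* Defs.v *)
From HB Require Import structures.
From mathcomp Require Import all_boot all_order all_algebra all_field.
From mathcomp Require Import generic_quotient finmap.
From mathcomp Require Import boolp classical_sets reals.
From mathcomp.multinomials Require Import monalg.
From mathcomp Require Import zify.

Set Implicit Arguments.
Unset Strict Implicit.
Unset Printing Implicit Defensive.

Import Order.TTheory GRing.Theory Num.Theory.
Local Open Scope ring_scope.
Local Open Scope quotient_scope.

(* Words in X = {x_1, x_2, ...} are sequences of naturals, the natural i
   standing for the variable x_(i+1). *)
Definition nzword : choiceType := {w : seq nat | w != [::]}.

(* v = N ++ M for some decomposition u = M ++ N, see cyc_relP *)
Definition cyc_rel (u v : nzword) : bool :=
  [exists i : 'I_(size (val u)).+1, rot i (val u) == val v].

Lemma cyc_relP (u v : nzword) :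
  reflect (exists M N, val u = M ++ N /\ val v = N ++ M) (cyc_rel u v).
Proof.
apply: (iffP existsP) => [[i /eqP <-]|[M [N [eu ev]]]].
  by exists (take i (val u)), (drop i (val u)); rewrite cat_take_drop.
have lt : (size M < (size (val u)).+1)%N by rewrite eu size_cat ltnS leq_addr.
by exists (Ordinal lt) => /=; rewrite eu ev rot_size_cat.
Qed.

Lemma cyc_rel_refl : reflexive cyc_rel.
Proof. by move=> u; apply/existsP; exists ord0; rewrite rot0. Qed.

Lemma cyc_rel_sym : symmetric cyc_rel.
Proof.
by move=> u v; apply/cyc_relP/cyc_relP=> -[M [N [-> ->]]]; exists N, M.
Qed.

Lemma cyc_rel_trans : transitive cyc_rel.
Proof.
move=> [v hv] [u hu] [w hw] /existsP[[i /= lei] /eqP eiv].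
case/existsP=> -[j /= lej] /eqP ejw; subst v; apply/existsP.
rewrite /= size_rot !ltnS in lei lej ejw *.
have lek : ((if (j + i <= size u) then j + i else j + i - size u) < (size u).+1)%N.
  by rewrite ltnS; case: ifP => // _; rewrite leq_subLR leq_add.
by exists (Ordinal lek); rewrite /= -rot_add_mod // ejw.
Qed.

Canonical cyc_equiv := EquivRel cyc_rel cyc_rel_refl cyc_rel_sym cyc_rel_trans.

(* The class of a word M is the indeterminate Tr(M). *)
Definition cycword := {eq_quot cyc_rel}.
HB.instance Definition _ := Choice.on cycword.
HB.instance Definition _ := EqQuotient.on cycword.

Section ProdMonomial.
Variables M N : monomType.
Implicit Types x y z : (M * N)%type.

Definition pmul x y : (M * N)%type := (mmul x.1 y.1, mmul x.2 y.2).
Definition pone : (M * N)%type := (mone, mone).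

Lemma pmulA : associative pmul.
Proof. by move=> x y z; rewrite /pmul !mulmA. Qed.
Lemma pmul1m : left_id pone pmul.
Proof. by case=> x y; rewrite /pmul !mul1m. Qed.
Lemma pmulm1 : right_id pone pmul.
Proof. by case=> x y; rewrite /pmul !mulm1. Qed.
Lemma punitm x y : pmul x y = pone -> x = pone /\ y = pone.
Proof.
by case: x y => [x1 x2] [y1 y2] [/unitm[/= -> ->] /unitm[/= -> ->]].
Qed.

HB.instance Definition _ :=
  Choice_isMonomialDef.Build (M * N)%type pmulA pmul1m pmulm1 punitm.
End ProdMonomial.

(* (w, t) is the monomial w * \prod_c c ^ t(c) *)
Definition tmonom : monomType := ({fmonom nat} * {cmonom cycword})%type.

(* F<X> (x) F[Tr(M)], as the monoid algebra of the product of the monoid of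
   words and of the free commutative monoid on the Tr(M). *)
Notation "{ 'freetr' F }" := {malg F[tmonom]}
  (at level 0, F at level 2, format "{ 'freetr'  F }") : type_scope.

Definition cyc_count (i : nat) (c : cycword) : nat :=
  count_mem i (val (repr c)).

(* Degree in x_(i+1), counting the letters inside the traces. *)
Definition degx (i : nat) (m : tmonom) : nat :=
  (count_mem i (m.1 : seq nat)
   + \sum_(c <- finsupp m.2) m.2 c * cyc_count i c)%N.

(* of degree 1 in each of x_1, ..., x_n and 0 in the other variables *)
Definition multilinear_monom (n : nat) (m : tmonom) : Prop :=
  forall i : nat, degx i m = (i < n)%N.

Definition MT (F : fieldType) (n : nat) : set {freetr F} :=
  [set f | forall m, m \in msupp f -> multilinear_monom n m].
Arguments MT : clear implicits.

Section Evaluation.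
Variables (F : fieldType) (A : falgType F) (tr : {scalar A}).

Definition is_trace : Prop := forall a b : A, tr (a * b) = tr (b * a).

Definition word_eval (a : nat -> A) (w : seq nat) : A := \prod_(i <- w) a i.

Definition cyc_eval (a : nat -> A) (c : cycword) : F :=
  tr (word_eval a (val (repr c))).

Definition tmonom_eval (a : nat -> A) (m : tmonom) : A :=
  (\prod_(c <- finsupp m.2) cyc_eval a c ^+ m.2 c) *: word_eval a m.1.

Definition freetr_eval (a : nat -> A) (f : {freetr F}) : A :=
  mmap (in_alg A) (tmonom_eval a) f.

Definition Idtr : set {freetr F} :=
  [set f | forall a : nat -> A, freetr_eval a f = 0].
End Evaluation.

Section EvaluationTheory.
Variables (F : fieldType) (A : falgType F) (tr : {scalar A}).
Hypothesis trC : is_trace tr.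
Variable a : nat -> A.

Lemma cyc_eval_pi (w : nzword) :
  cyc_eval tr a (\pi_cycword w) = tr (word_eval a (val w)).
Proof.
rewrite /cyc_eval; case: piP => v /eqmodP /cyc_relP[M [N [-> ->]]].
by rewrite /word_eval !big_cat trC.
Qed.

Lemma tmonom_eval_is_mmorphism : mmorphism (tmonom_eval tr a).
Proof.
split=> [[w s] [w' s']|]; last first.
  by rewrite /tmonom_eval /word_eval mdom1 big_seq_fset0 fm1 big_nil scale1r.
rewrite /tmonom_eval /= /word_eval fmM big_cat /= -scalerAl -scalerAr scalerA.
congr (_ *: _); rewrite mdomD.
have ext (t : {cmonom cycword}) (E : {fset cycword}) : (finsupp t `<=` E)%fset ->
    \prod_(c <- finsupp t) cyc_eval tr a c ^+ t c
    = \prod_(c <- E) cyc_eval tr a c ^+ t c.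
  move=> le; rewrite (big_fset_incl _ le) // => c _.
  by rewrite -cmE_neq0 negbK => /eqP->.
rewrite (ext s _ (fsubsetUl _ (finsupp s'))) (ext s' _ (fsubsetUr (finsupp s) _)).
by rewrite -big_split; apply: eq_bigr => c _; rewrite cmM exprD.
Qed.

HB.instance Definition _ :=
  isMultiplicative.Build tmonom A (tmonom_eval tr a) tmonom_eval_is_mmorphism.

Lemma freetr_eval_linear : linear (freetr_eval tr a).
Proof.
by move=> c f g; rewrite /freetr_eval mmapD mmapZ /= mulr_algl.
Qed.

Lemma freetr_eval_multiplicative : multiplicative (freetr_eval tr a).
Proof.
apply: commr_mmap_is_multiplicative => g m m'.
by rewrite /GRing.comm /= mulr_algl mulr_algr.
Qed.
End EvaluationTheory.

(* d is the dimension of M / (M `&` I), for subspaces M and I of V *)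
Definition is_quot_dim (F : fieldType) (V : lmodType F) (M I : set V)
    (d : nat) : Prop :=
  exists e : 'I_d -> V,
    [/\ forall i, M (e i),
        forall c : 'I_d -> F, I (\sum_i c i *: e i) -> forall i, c i = 0
      & forall v, M v -> exists c : 'I_d -> F, I (v - \sum_i c i *: e i)].

Section QuotDim.
Variables (F : fieldType) (V : lmodType F) (M I : set V).
Hypothesis I0 : I 0.
Hypothesis Ilin : forall (c : F) u v, I u -> I v -> I (c *: u + v).

Let ID u v : I u -> I v -> I (u + v).
Proof. by move=> Iu Iv; rewrite -[u]scale1r; apply: Ilin. Qed.

Let IZ c u : I u -> I (c *: u).
Proof. by move=> Iu; rewrite -[_ *: _]addr0; apply: Ilin. Qed.

Let indep d (e : 'I_d -> V) :=
  forall c : 'I_d -> F, I (\sum_i c i *: e i) -> forall i, c i = 0.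

Let indep_leq d N (e : 'I_d -> V) (b : 'I_N -> V) : indep e ->
    (forall i, exists c : 'I_N -> F, I (e i - \sum_j c j *: b j)) ->
  (d <= N)%N.
Proof.
move=> ind /choice[P HP]; rewrite leqNgt; apply/negP => ltNd.
pose B : 'M[F]_(d, N) := \matrix_(i, j) P i j.
have : kermx B != 0.
  rewrite -mxrank_eq0 mxrank_ker -lt0n subn_gt0.
  exact: leq_ltn_trans (rank_leq_col B) ltNd.
case/rowV0Pn => u /sub_kermxP uB /negP; apply; apply/eqP/rowP => i.
rewrite mxE; apply: (ind (fun i => u 0 i)).
have -> : \sum_i u 0 i *: e i = \sum_i u 0 i *: (e i - \sum_j P i j *: b j).
  under [RHS]eq_bigr do rewrite scalerBr; rewrite sumrB.
  suff -> : \sum_i u 0 i *: (\sum_j P i j *: b j) = 0 by rewrite subr0.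
  under eq_bigr do rewrite scaler_sumr; rewrite exchange_big big1 // => j _.
  under eq_bigr do rewrite scalerA; rewrite -scaler_suml.
  move/rowP/(_ j): uB; rewrite !mxE.
  by under eq_bigr do rewrite mxE; move=> ->; rewrite scale0r.
by elim/big_ind: _ => // k _; apply: IZ.
Qed.

Lemma is_quot_dim_uniq d d' : is_quot_dim M I d -> is_quot_dim M I d' -> d = d'.
Proof.
move=> [e [Me ie se]] [e' [Me' ie' se']]; apply/eqP; rewrite eqn_leq.
by rewrite (indep_leq ie (fun i => se' _ (Me i)))
           (indep_leq ie' (fun i => se _ (Me' i))).
Qed.

Lemma is_quot_dim_exists N (b : 'I_N -> V) :
    (forall v, M v -> exists c : 'I_N -> F, v = \sum_j c j *: b j) ->
  exists d, is_quot_dim M I d.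
Proof.
move=> sb; pose P d := `[< exists2 e : 'I_d -> V, forall i, M (e i) & indep e >].
have exP : exists d, P d.
  by exists 0%N; apply/asboolP; exists (fun _ => 0) => [[]|? ? []].
have leP d : P d -> (d <= N)%N.
  move=> /asboolP[e Me ie]; apply: (indep_leq (b := b) ie) => i.
  by have [c ->] := sb _ (Me i); exists c; rewrite subrr.
case: (ex_maxnP exP leP) => d /asboolP[e Me ie] maxd.
exists d, e; split=> // v Mv; apply: contrapT => nsp.
suff /maxd : P d.+1 by rewrite ltnn.
apply/asboolP.
exists (fun i => if unlift ord_max i is Some j then e j else v).
  by move=> i; case: unlift.
move=> c; rewrite big_ord_recr /= unlift_none.
under eq_bigr => i _.
  have -> : widen_ord (leqnSn d) i = lift ord_max i.
    by apply/val_inj; rewrite /= /bump leqNgt ltn_ord.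
  rewrite liftK; over.
set f := fun i => c (lift ord_max i).
have [cm0 | cm0] := eqVneq (c ord_max) 0.
  rewrite cm0 scale0r addr0 => /(ie f) f0 i.
  by case: (unliftP ord_max i) => [j ->|->] //; apply: f0.
move=> /(IZ (c ord_max)^-1); rewrite scalerDr scalerA mulVf // scale1r => H.
case: nsp; exists (fun i => - ((c ord_max)^-1 * f i)).
under eq_bigr do rewrite scaleNr -scalerA.
by rewrite sumrN opprK addrC -scaler_sumr.
Qed.
End QuotDim.

(* Such a dimension exists and is unique, see ctrP and is_quot_dim_uniq. *)
Definition ctr (F : fieldType) (A : falgType F) (tr : {scalar A}) (n : nat)
    : nat :=
  xget 0%N [set d | is_quot_dim (MT F n) (Idtr tr) d].

Section Finiteness.

Let words : nat -> nat -> seq (seq nat) := fun n =>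
  fix words k := if k is k'.+1
    then [::] :: [seq x :: w | x <- iota 0 n, w <- words k'] else [:: [::]].

Let mem_words n k (w : seq nat) :
  all (fun i => i < n)%N w -> (size w <= k)%N -> w \in words n k.
Proof.
elim: k w => [|k IH] [|x w] //= /andP[xn wn] szw.
by rewrite inE; apply/orP; right; apply: allpairs_f;
  [rewrite mem_iota | apply: IH].
Qed.

Let mem_words_count n (w : seq nat) :
  (forall i, count_mem i w <= (i < n))%N -> w \in words n n.
Proof.
move=> cw; have lt i : i \in w -> (i < n)%N.
  rewrite -has_pred1 has_count; case: (i < n)%N (cw i) => //.
  by rewrite leqn0 => /eqP->.
apply: mem_words; first exact/allP.
rewrite -[X in (_ <= X)%N](size_iota 0 n); apply: uniq_leq_size => [|i /lt].
  apply/count_mem_uniq => i; rewrite -has_pred1 has_count.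
  by have := leq_trans (cw i) (leq_b1 _); case: (count_mem i w) => [|[]].
by rewrite mem_iota.
Qed.

Lemma multilinear_monom_finite n :
  exists E : {fset tmonom}, forall m, multilinear_monom n m -> m \in E.
Proof.
pose C : seq cycword := pmap (fun w => omap \pi_cycword (insub w)) (words n n).
pose g (D : {fset cycword}) : {cmonom cycword} := [cmonom 1%N | c in D]%M.
exists (seq_fset tt [seq (FMonom w, g D) | w <- words n n,
                                  D <- fpowerset (seq_fset tt C)]).
case=> w s mm; rewrite seq_fsetE.
have cw i : (count_mem i w <= (i < n))%N by rewrite -mm leq_addr.
have cs c i : c \in finsupp s -> (s c * cyc_count i c <= (i < n))%N.
  by move=> cs; rewrite -mm /degx /= (big_fsetD1 c) //= addnCA leq_addr.
have s1 c : s c = (c \in finsupp s).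
  case: mdomP => // cin; apply/eqP; rewrite eqn_leq lt0n cmE_neq0 cin andbT.
  have : val (repr c) != [::] := valP (repr c).
  case e : (val (repr c)) => [//|i l] _; move: (leq_trans (cs c i cin) (leq_b1 _)).
  by rewrite /cyc_count e /= eqxx; apply: leq_trans; rewrite leq_pmulr.
have -> : (w, s) = (FMonom w, g (finsupp s)).
  congr pair; first by rewrite fmK.
  by apply/eqP/cmP => c; rewrite /g cmE fsfun_fun s1; case: ifP.
apply: allpairs_f; first exact: mem_words_count.
rewrite fpowersetE; apply/fsubsetP => c cin; rewrite seq_fsetE mem_pmap.
apply/mapP; exists (val (repr c)); last by rewrite valK /= reprK.
apply: mem_words_count => i; have := cs c i cin.
by rewrite s1 cin mul1n.
Qed.

Lemma ctrP (F : fieldType) (A : falgType F) (tr : {scalar A}) n :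
  is_quot_dim (MT F n) (Idtr tr) (ctr tr n).
Proof.
rewrite /ctr; case: xgetP => [d -> //|] no.
have [E HE] := multilinear_monom_finite n.
have I0 : Idtr tr 0 by move=> a; rewrite /freetr_eval mmap0.
have Ilin (c : F) u v : Idtr tr u -> Idtr tr v -> Idtr tr (c *: u + v).
  by move=> Iu Iv a; rewrite freetr_eval_linear Iu Iv scaler0 addr0.
pose b (j : 'I_(size E)) : {freetr F} := << tnth (in_tuple E) j >>.
have [|d] := @is_quot_dim_exists F {freetr F} (MT F n) (Idtr tr) I0 Ilin _ b.
  move=> f Mf; exists (fun j => f@_(tnth (in_tuple E) j)).
  rewrite {1}(@monalgEw _ _ f E); last by apply/fsubsetP => m /Mf /HE.
  rewrite big_tnth; apply: eq_bigr => j _.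
  by apply/malgP => k; rewrite mcoeffZ !mcoeffU mulr_natr.
by move/no.
Qed.
End Finiteness.

Definition poly_bounded (R : realType) (c : nat -> nat) : Prop :=
  exists p : {poly R}, forall n, (0 < n)%N -> (c n)%:R <= p.[n%:R].

Definition exp_growth (R : realType) (c : nat -> nat) : Prop :=
  exists C b : R,
    [/\ 0 < C, 1 < b & forall n, (0 < n)%N -> C * b ^+ n <= (c n)%:R].

(* Main.v *)
Require Import Defs.
From mathcomp Require Import all_boot all_order all_algebra all_field reals.
From mathcomp Require Import boolp finmap ring zify.
From mathcomp.multinomials Require Import monalg.
Set Implicit Arguments.
Unset Strict Implicit.
Unset Printing Implicit Defensive.
Import GRing.Theory Num.Theory.
Local Open Scope ring_scope.
Local Open Scope quotient_scope.

(** The growth of the codimensions is governed by two nilpotency conditions,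
both of which make sense over [F] itself, so that no extension of scalars and
no Wedderburn-Malcev decomposition enters the argument.

- Suppose that [ad x] is not nilpotent for some [x].  Substitute 1 or [x] for
  all variables but one, and the remaining one by some [y].  Each letter of a
  word then acts on [y] by the left or by the right multiplication by 1 or [x].
  These operators commute, and the determinant of the two pairs is [ad x] up to
  sign; as it is not nilpotent, the 2 ^ n ways to put [n] letters to the left
  or to the right of [x_0] are linearly independent ([opwords_indep],
  [not_engel_exp_growth]).
- Suppose that [tr 1 *: x - (tr x)%:A] is not nilpotent for some [x].  The same
  computation applies to the 2 ^ n ways to put each of [n] letters inside a
  trace of its own or outside, since the determinant is now the multiplication
  by this element ([trace_exp_growth]).

If neither happens, growth is polynomial.  All [ad x] being nilpotent,
idempotents are central, and Fitting idempotents show that the nilpotent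
elements form an ideal; by finite dimension, all products of sufficiently many
nilpotent elements vanish ([engel_nilpotent]).  It then suffices to write each
[x] as [p x + q x] with [p x] central and [q x] nilpotent, in such a way that
the trace of a word is a constant times the product of the [p] of its letters
([poly_bounded_split]): expanding a multilinear monomial leaves only products
with fewer than a fixed number of factors [q], and there are polynomially many
of these.

- If [tr 1 != 0], then [x - (tr x / tr 1)%:A] is always nilpotent, hence
  [tr / tr 1] is multiplicative, because its kernel is an ideal, and one takes
  [p x := (tr x / tr 1)%:A] ([multiplicative_trace_poly_bounded]).
- If [tr 1 = 0], then [tr x] is a nilpotent scalar for all [x], so [tr = 0] and
  any such [p] will do ([traceless_poly_bounded]).  One takes
  [p a] to be a polynomial [f] in [a] with [a - f.[a]] nilpotent such that
  [f^`()] vanishes at [a] to high order: by the Taylor formula for [ad a], the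
  commutator of [f.[a]] with any [b] only involves the derivatives of [f] at
  [a] times high powers of the nilpotent [ad a] ([engel_central_part]). *)

(** * Nilpotent elements of an Engel algebra *)

Section Nilpotent.
Variables (F : fieldType) (A : falgType F).
Implicit Types x y a b e : A.

Definition nilp x := exists k, x ^+ k = 0.
Definition ad x y := x * y - y * x.
Definition engel := forall x, exists k, forall y, iter k (ad x) y = 0.

Lemma linear_dep (N : nat) (u : 'I_N -> A) : (\dim {:A} < N)%N ->
  exists2 c : 'I_N -> F, \sum_i c i *: u i = 0 & exists i, c i != 0.
Proof.
move=> ltN; pose X := [tuple u i | i < N].
have : ~~ free X.
  apply: contraL ltN => /eqP frX; rewrite -leqNgt -[N](size_tuple X) -frX.
  by apply: dimvS; apply: subvf.
move=> /negP nfr.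
apply: contrapT => no; apply: nfr; apply/freeP => c c0 i.
apply: contrapT => ci; apply: no; exists c; last by exists i; apply/eqP.
by rewrite -[RHS]c0; apply: eq_bigr => j _; rewrite -tnth_nth tnth_mktuple.
Qed.

Lemma annihilating_poly a : exists2 p : {poly F}, p != 0 & horner_alg a p = 0.
Proof.
have [c c0 [i ci]] := linear_dep (fun i : 'I__ => a ^+ i) (ltnSn (\dim {:A})).
exists (\poly_(j < (\dim {:A}).+1) c (inord j)).
  apply: contra ci => /eqP/polyP/(_ (i : nat)).
  by rewrite coef0 coef_poly ltn_ord inord_val => ->.
rewrite poly_def linear_sum /= -[RHS]c0; apply: eq_bigr => j _.
by rewrite linearZ rmorphXn /= horner_algX inord_val mulr_algl.
Qed.

(** An annihilating polynomial of [a], divided by its lowest coefficient, reads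
['X^m * (1 - r * 'X)]; hence [a ^+ m] is unchanged when multiplied by powers of
[r.[a] * a], and [r.[a] ^+ m.+1 * a ^+ m.+1] is idempotent. *)
Lemma fitting_idempotent a : exists e y,
  [/\ e = a * y, e * e = e & e = 0 -> nilp a].
Proof.
have [p p0 pa] := annihilating_poly a.
have [m [q]] := multiplicity_XsubC p 0; rewrite p0 subr0 /= => nr pE.
pose c := q.[0]; have c0 : c != 0 by [].
have /factor_theorem[s] : root (q - c%:P) 0 by rewrite rootE !hornerE subrr.
rewrite subr0 => /eqP; rewrite subr_eq => /eqP qE.
pose h : {poly F} -> A := horner_alg a; pose r : {poly F} := - (c^-1 *: s).
have hM p1 p2 : h (p1 * p2) = h p1 * h p2 by rewrite /h rmorphM.
have h1 : h 'X = a by rewrite /h horner_algX.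
have hX : h 'X^m = h (r * 'X^(m.+1)).
  apply/eqP; rewrite -subr_eq0 -rmorphB /=; apply/eqP.
  suff -> : 'X^m - r * 'X^(m.+1) = c^-1 *: p by rewrite linearZ /= pa mulr0.
  rewrite pE qE /r mulrDl scalerDr addrC; congr (_ + _); last first.
    by rewrite -mul_polyC mulrA -polyCM mulVf // mul1r.
  by rewrite mulNr opprK exprS mulrA !scalerAl.
have hXj j : h 'X^(m.+1) = h (r ^+ j * 'X^(m.+1 + j)).
  elim: j => [|j IHj]; first by rewrite mul1r addn0.
  rewrite IHj addSnnS exprD !hM hX -!hM; congr h.
  by rewrite -(mulrA r) -exprD mulrA -exprSr.
exists (h (r ^+ m.+1 * 'X^(m.+1))), (h (r ^+ m.+1 * 'X^m)); split.
- by rewrite -h1 -hM mulrCA -exprS.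
- by rewrite -hM mulrCA -(mulrA (r ^+ _) 'X^_ 'X^_) -exprD [LHS]hM -hXj -hM.
- move=> e0; exists m.+1; have := hXj m.+1.
  by rewrite exprD mulrA hM e0 mul0r /h rmorphXn /= horner_algX.
Qed.

(** The two off-diagonal Peirce components of [b] are eigenvectors of [ad e] for
the eigenvalues 1 and -1. *)
Lemma engel_idempotent_central e : engel -> e * e = e -> forall b, e * b = b * e.
Proof.
move=> eng ee b; have [k ek] := eng e.
have h1 : iter k (ad e) (e * b - e * b * e) = e * b - e * b * e.
  elim: k {ek} => //= k ->; rewrite /ad mulrBr mulrBl !mulrA ee.
  by rewrite -(mulrA (e * b)) ee subrr subr0.
pose z := b * e - e * b * e.
have adz : ad e z = - z.
  rewrite /ad mulrBr mulrBl !mulrA ee subrr sub0r -!mulrA ee.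
  by rewrite -/(z) /z !mulrA.
have h2 : iter k (ad e) z = z \/ iter k (ad e) z = - z.
  elim: k {ek h1} => [|k [] IHk]; [by left| |] => /=; rewrite IHk ?adz; [by right|].
  by left; rewrite -[RHS]opprK -[X in _ = - X]adz /ad mulrN mulNr opprD.
have z0 : z = 0.
  by case: h2; rewrite ek => // /esym/eqP; rewrite oppr_eq0 => /eqP.
have /eqP : e * b - e * b * e = 0 by rewrite -h1.
by move/eqP: z0; rewrite !subr_eq0 => /eqP be /eqP eb; rewrite eb.
Qed.

(** The Fitting idempotent [e] of [x * y] is [x * v] for some [v]; being central
and idempotent, it is also [x ^+ k * e * v ^+ k] for all [k]. *)
Lemma engel_nilpMr x y : engel -> nilp x -> nilp (x * y).
Proof.
move=> eng [k xk]; have [e [u [eE ee e0]]] := fitting_idempotent (x * y).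
apply: e0; have ec := engel_idempotent_central eng ee.
have eu : e = x * e * (y * u).
  by rewrite -(mulrA x) ec !mulrA -eE ee.
suff -> : e = x ^+ k * e * (y * u) ^+ k by rewrite xk !mul0r.
elim: {xk} k => [|k IHk]; first by rewrite mul1r mulr1.
by rewrite {1}IHk {1}eu exprSr exprS !mulrA.
Qed.

Lemma engel_nilpMl x y : engel -> nilp x -> nilp (y * x).
Proof.
move=> eng nx; have [k xyk] := engel_nilpMr y eng nx; exists k.+1.
suff -> : (y * x) ^+ k.+1 = y * (x * y) ^+ k * x by rewrite xyk mulr0 mul0r.
elim: {xyk} k => [|k IHk]; first by rewrite mulr1.
by rewrite exprS IHk [in RHS]exprS !mulrA.
Qed.

(** The Fitting idempotent of [x + y] is the sum of a multiple of [x] and a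
multiple of [y], both nilpotent; as it is central, it commutes with them. *)
Lemma engel_nilpD x y : engel -> nilp x -> nilp y -> nilp (x + y).
Proof.
move=> eng nx ny; have [e [u [eE ee e0]]] := fitting_idempotent (x + y).
apply: e0; have ec := engel_idempotent_central eng ee.
have [k xuk] := engel_nilpMr u eng nx.
have nyu := engel_nilpMr u eng ny.
have eX n : e ^+ n.+1 = e by elim: n => //= n IHn; rewrite exprS IHn.
have [l el] : nilp e.
  have := subrXX_comm k.+1 (ec (x * u)).
  rewrite eX exprS xuk mulr0 subr0 => ->; apply: engel_nilpMr => //.
  by rewrite eE mulrDl addrAC subrr add0r.
by rewrite -(eX l) exprS el mulr0.
Qed.

Lemma nilpZ c x : nilp x -> nilp (c *: x).
Proof. by case=> k xk; exists k; rewrite exprZn xk scaler0. Qed.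

Lemma nilp0 : nilp 0. Proof. by exists 1%N. Qed.


(** Such a subspace is one of maximal dimension among those that consist of
nilpotent elements. *)
Lemma engel_nil_subspace : engel ->
  exists U : {vspace A}, forall x, x \in U <-> nilp x.
Proof.
move=> eng.
pose P d := `[< exists2 U : {vspace A}, \dim U = d & forall x, x \in U -> nilp x >].
have exP : exists d, P d.
  exists 0%N; apply/asboolP; exists 0%VS; rewrite ?dimv0 // => x.
  by rewrite memv0 => /eqP ->; apply: nilp0.
have leP d : P d -> (d <= \dim {:A})%N.
  by move=> /asboolP[U <- _]; apply: dimvS; apply: subvf.
case: (ex_maxnP exP leP) => d /asboolP[U dU nU] maxd.
exists U => x; split=> [/nU // | nx].
have /maxd : P (\dim (U + <[x]>)%VS).
  apply/asboolP; exists (U + <[x]>)%VS => // _ /memv_addP[u uU [v /vlineP[c ->] ->]].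
  by apply: engel_nilpD => //; [apply: nU | apply: nilpZ].
rewrite -dU => le; have /eqP -> : U == (U + <[x]>)%VS.
  by rewrite eqEdim addvSl.
by apply: subvP (addvSr U <[x]>) x (memv_line x).
Qed.

(** Otherwise take [W] of minimal dimension among the subspaces stable under [K]
with [W * K != 0].  Some [w] in [W] has [w K != 0], and minimality
forces [w K = W], so [w = w * x] with [x] in [K] nilpotent. *)
Lemma nil_idempotent_eq0 (K : {vspace A}) :
  (forall x, x \in K -> nilp x) -> (K * K)%VS = K -> K = 0%VS.
Proof.
move=> nK KK; apply/eqP; apply: contrapT => /negP K0.
pose P d := `[< exists W : {vspace A},
  [/\ \dim W = d, (W * K <= W)%VS & (W * K != 0)%VS] >].
have exP : exists d, P d.
  by exists (\dim K); apply/asboolP; exists K; rewrite KK subvv.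
case: (ex_minnP exP) => d /asboolP[W [dW WK WK0]] mind.
have [w wW wK0] : exists2 w, w \in W & (<[w]> * K != 0)%VS.
  apply: contrapT => no; move/negP: WK0; apply; rewrite -subv0; apply/prodvP => w x wW xK.
  apply: contrapT => wx; apply: no; exists w => //; apply/negP => /eqP wK.
  by apply: wx; rewrite -wK memv_mul ?memv_line.
have sW : (<[w]> * K <= W)%VS.
  by apply: subv_trans WK; apply: prodvSl; rewrite -memvE.
have /mind : P (\dim (<[w]> * K)%VS).
  by apply/asboolP; exists (<[w]> * K)%VS; rewrite -prodvA KK subvv.
rewrite -dW => le; have /eqP eW : (<[w]> * K)%VS == W by rewrite eqEdim sW.
have : (<[w]> * K <= amull w @: K)%VS.
  apply/prodvP => _ x /vlineP[c ->] xK; apply/memv_imgP; exists (c *: x).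
    by rewrite memvZ.
  by rewrite lfunE /= -scalerAl scalerAr.
rewrite eW => /subvP/(_ w wW)/memv_imgP[x xK]; rewrite lfunE /= => wx.
have [k xk] := nK x xK; move/negP: wK0; apply.
suff -> : w = w * x ^+ k by rewrite xk mulr0 prod0v.
by elim: {xk} k => [|k IHk]; rewrite ?mulr1 // exprSr mulrA -IHk.
Qed.

(** The powers of [U] decrease, so they stabilise at an idempotent subspace. *)
Lemma nil_subspace_nilpotent (U : {vspace A}) :
  (forall x, x \in U -> nilp x) -> (U * U <= U)%VS -> exists m, (U ^+ m.+1 = 0)%VS.
Proof.
move=> nU UU; have dec j k : (U ^+ (j + k).+1 <= U ^+ k.+1)%VS.
  elim: j => // j IHj; rewrite addSn expvSl; apply: subv_trans IHj.
  by rewrite expvSl prodvA; apply: prodvSl.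
pose P d := `[< exists m, \dim (U ^+ m.+1)%VS = d >].
have exP : exists d, P d by exists (\dim U); apply/asboolP; exists 0%N.
case: (ex_minnP exP) => d /asboolP[m dm] mind; exists m.
apply: nil_idempotent_eq0 => [x xU|].
  by apply: nU; apply: subvP x xU; have := dec m 0%N; rewrite addn0.
have : P (\dim (U ^+ (m.+1 + m).+1)%VS) by apply/asboolP; exists (m.+1 + m)%N.
by move/mind; rewrite -dm => le; apply/eqP; rewrite -expvD addnS eqEdim dec.
Qed.

Lemma engel_nilpotent : engel -> exists m, forall s : seq A,
  (forall x, x \in s -> nilp x) -> (m < size s)%N -> \prod_(x <- s) x = 0.
Proof.
move=> eng; have [U nU] := engel_nil_subspace eng.
have UU : (U * U <= U)%VS.
  apply/prodvP => x y xU _; apply/nU/engel_nilpMr => //; exact/nU.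
have [|m Um] := nil_subspace_nilpotent _ UU; first by move=> x /nU.
exists m => s ns ltm; apply/eqP; rewrite -memv0 -Um -(cat_take_drop m.+1 s) big_cat /=.
have memX (t : seq A) : (forall x, x \in t -> nilp x) ->
    \prod_(x <- t) x \in (U ^+ size t)%VS.
  elim: t => [|x t IHt] nt; first by rewrite big_nil expv0 memv_line.
  rewrite big_cons expvSl; apply: memv_mul.
    by apply/nU/nt; rewrite mem_head.
  by apply: IHt => y yt; apply: nt; rewrite inE yt orbT.
have : \prod_(x <- take m.+1 s) x \in (U ^+ m.+1)%VS.
  have := memX (take m.+1 s); rewrite size_takel //; apply => x /mem_take; exact: ns.
by rewrite Um memv0 => /eqP ->; rewrite mul0r mem0v.
Qed.
End Nilpotent.

(** * Central parts in characteristic zero *)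

Lemma pchar0_deriv_eq0 (F : fieldType) (p : {poly F}) : [pchar F] =i pred0 ->
  (1 < size p)%N -> p^`() != 0.
Proof.
move=> /pcharf0P ch sp; apply/eqP => /polyP/(_ (size p).-2).
have sE : ((size p).-2.+1 = (size p).-1)%N by case: (size p) sp => [|[]].
rewrite coef_deriv coef0 sE -mulr_natr => /eqP; rewrite mulf_eq0 ch -sE orbF sE.
by rewrite -/(lead_coef p) lead_coef_eq0; case: eqP sp => // ->; rewrite size_poly0.
Qed.

(** Newton-like iteration: replacing [f] by [f + g ^+ k.+1 * t] changes
[f^`() = w * g ^+ k] by [k.+1 * g^`() * t * g ^+ k] modulo [g ^+ k.+1], and [t]
can be chosen to cancel [w] because [g^`()] and [k.+1] are invertible modulo
[g]. *)
Lemma deriv_flat_lift (F : fieldType) (g : {poly F}) : [pchar F] =i pred0 ->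
  coprimep g g^`() ->
  forall k, exists2 f : {poly F}, g %| f - 'X & g ^+ k %| f^`().
Proof.
move=> /pcharf0P ch /Bezout_eq1_coprimepP[[u v] /= uv]; elim=> [|k [f gf /dvdpP[w fE]]].
  by exists 'X; rewrite ?subrr ?dvdp0 ?dvd1p.
pose t := - (k.+1%:R^-1 *: (v * w)).
exists (f + g ^+ k.+1 * t).
  by rewrite addrAC dvdp_add // exprS -mulrA dvdp_mulr.
rewrite derivD derivM deriv_exp fE addrA dvdp_add ?dvdp_mulIl //=.
have tE : t *+ k.+1 = - (v * w).
  by rewrite /t mulNrn -scaler_nat scalerA mulfV ?scale1r // ch.
rewrite mulrnAl -mulrnAr tE -[w in w * _]mulr1 -uv.
have -> : w * (u * g + v * g^`()) * g ^+ k + g^`() * g ^+ k * - (v * w)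
   = g ^+ k.+1 * (w * u) by rewrite exprS; ring.
exact: dvdp_mulIl.
Qed.

Section CentralPart.
Variables (F : fieldType) (A : falgType F).
Hypothesis charF : [pchar F] =i pred0.
Implicit Types a b x : A.

(** The polynomials [p] with [p.[a]] nilpotent form a radical ideal, so that a
nonzero one of minimal degree is square-free. *)
Lemma nilp_separable_poly a :
  exists2 g : {poly F}, coprimep g g^`() & nilp (horner_alg a g).
Proof.
pose P d := `[< exists p : {poly F},
  [/\ size p = d, p != 0 & nilp (horner_alg a p)] >].
have exP : exists d, P d.
  have [p p0 pa] := annihilating_poly a.
  by exists (size p); apply/asboolP; exists p; rewrite pa; split=> //; apply: nilp0.
case: (ex_minnP exP) => d /asboolP[g [<- g0 [k ng]]] ming.
exists g; last by exists k.
suff : separable_poly g by rewrite unlock.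
apply/separable_polyP; split; last first.
  by move=> u _; apply: pchar0_deriv_eq0.
apply/poly_square_freeP => u su; apply/negP => /dvdpP[w gE].
have [w0 u0] : w != 0 /\ u != 0.
  move: g0; rewrite gE mulf_eq0 negb_or => /andP[-> u2]; split=> //.
  by apply: contra u2 => /eqP ->; rewrite expr0n.
have /ming : P (size (w * u)).
  apply/asboolP; exists (w * u); rewrite mulf_neq0 //; split=> //.
  exists (k + k)%N; rewrite -rmorphXn exprD -exprMn.
  have -> : w * u * (w * u) = w * g by rewrite gE; ring.
  by rewrite exprMn rmorphM [X in _ * X]rmorphXn ng mulr0.
rewrite gE mulrA size_proper_mul; last by rewrite mulf_neq0 ?lead_coef_eq0 ?mulf_neq0.
have : (1 < size u)%N by rewrite ltn_neqAle eq_sym su lt0n size_poly_eq0.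
have : (0 < size (w * u)%R)%N by rewrite lt0n size_poly_eq0 mulf_neq0.
have gen n m : (0 < n -> 1 < m -> (n + m).-1 <= n -> False)%N by lia.
exact: gen.
Qed.

(** Left multiplication by [a] is the sum of right multiplication by [a] and of
[ad a], which commute: this is the Taylor formula for [p] at their sum. *)
Lemma taylor_ad a B : (forall b, iter B.+1 (ad a) b = 0) ->
  forall (p : {poly F}) b, horner_alg a p * b =
    \sum_(i < B.+1) iter i (ad a) b * horner_alg a p^`N(i).
Proof.
move=> adB; elim/poly_ind => [|p c IHp] b.
  by rewrite raddf0 mul0r big1 // => i _; rewrite raddf0 raddf0 mulr0.
set h := horner_alg a.
have hX q : h (q * 'X) = a * h q by rewrite mulrC /h rmorphM /= horner_algX.
rewrite big_ord_recl nderivn0 [h _]rmorphD /= -/h hX.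
under eq_bigr do rewrite nderivnMXaddC [h _]rmorphD /= -/h hX mulrDr.
rewrite big_split /= mulrDl -mulrA IHp mulr_sumr.
have adE i : a * iter i (ad a) b = iter i.+1 (ad a) b + iter i (ad a) b * a.
  by rewrite /= /ad subrK.
rewrite (eq_bigr (fun i : 'I__ => iter i.+1 (ad a) b * h p^`N(i)
    + iter i (ad a) b * (a * h p^`N(i)))) => [|i _]; last first.
  by rewrite [LHS]mulrA adE mulrDl -mulrA.
rewrite big_split big_ord_recr adB mul0r /= addr0.
rewrite [X in _ + X + _]big_ord_recl nderivn0 mulrDr.
rewrite [h c%:P]horner_algC mulr_algl mulr_algr /=.
by rewrite [RHS]addrAC addrCA.
Qed.

(** Each derivation lowers by at most one the multiplicity of a factor. *)
Lemma dvdp_derivn (g p : {poly F}) j i :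
  g ^+ (j + i) %| p -> g ^+ j %| p^`(i).
Proof.
elim: i p => [|i IHi] p; first by rewrite addn0 derivn0.
rewrite addnS derivSn exprSr => /dvdpP[q ->]; apply: IHi.
rewrite derivM [in X in _ + X]derivM deriv_exp.
case: (j + i)%N => [|n]; first by rewrite dvd1p.
rewrite /= mulrnAl -mulrA -(exprSr g n).
apply: dvdp_add; first by rewrite dvdp_mull // dvdp_mulIl.
apply/dvdp_mull/dvdp_add; last exact: dvdp_mulIl.
by rewrite -mulrnAl dvdp_mull.
Qed.

Lemma engel_central_part a : engel A ->
  exists2 s : A, nilp (a - s) & forall b, s * b = b * s.
Proof.
move=> eng; have [g cg [M gM]] := nilp_separable_poly a.
have [B adB] := eng a.
have [f fX f'] := deriv_flat_lift charF cg (M + B).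
exists (horner_alg a f) => [|b].
  move/dvdpP: fX => [q fE]; exists M.
  have -> : a - horner_alg a f = - horner_alg a (q * g).
    by rewrite -fE rmorphB /= horner_algX opprB.
  by rewrite -rmorphN -mulNr -rmorphXn exprMn rmorphM [X in _ * X]rmorphXn gM mulr0.
have ad0 : ad a 0 = 0 by rewrite /ad mulr0 mul0r subrr.
rewrite (@taylor_ad a B) => [|c]; last by rewrite iterS adB ad0.
rewrite big_ord_recl nderivn0 big1 ?addr0 // => i _.
suff -> : horner_alg a f^`N(lift ord0 i) = 0 by rewrite mulr0.
have : horner_alg a f^`(lift ord0 i) = 0.
  have : g ^+ M %| f^`(lift ord0 i).
    rewrite derivSn; apply: dvdp_derivn; apply: dvdp_trans f'.
    by apply: dvdp_exp2l; rewrite leq_add2l ltnW.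
  by case/dvdpP=> q ->; rewrite rmorphM rmorphXn /= gM mulr0.
rewrite nderivn_def raddfMn -scaler_nat => /eqP; rewrite scaler_eq0.
by have /pcharf0P -> := charF; rewrite eqn0Ngt fact_gt0 => /eqP.
Qed.
End CentralPart.

(** * Codimensions and evaluations of monomials *)

Section Monomials.
Variables (F : fieldType) (A : falgType F) (tr : {scalar A}).
Hypothesis trC : is_trace tr.

Lemma mulmx_kernel (N d : nat) (C : 'M[F]_(N, d)) : (d < N)%N ->
  exists2 u : 'rV[F]_N, u != 0 & u *m C = 0.
Proof.
move=> ltdN; have : kermx C != 0.
  rewrite -mxrank_eq0 mxrank_ker -lt0n subn_gt0.
  exact: leq_ltn_trans (rank_leq_col C) ltdN.
by case/rowV0Pn => u /sub_kermxP uC u0; exists u.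
Qed.

Lemma freetr_eval_sum (T : Type) (r : seq T) (c : T -> F) (f : T -> {freetr F}) a :
  freetr_eval tr a (\sum_(i <- r) c i *: f i) =
  \sum_(i <- r) c i *: freetr_eval tr a (f i).
Proof.
elim: r => [|i r IHr]; first by rewrite !big_nil /freetr_eval mmap0.
by rewrite !big_cons freetr_eval_linear IHr.
Qed.

Lemma freetr_evalU a (m : tmonom) : freetr_eval tr a << m >> = tmonom_eval tr a m.
Proof. by rewrite /freetr_eval mmapU /= scale1r mul1r. Qed.

(** The [phi j] range over arbitrary functions, so that they can use parts of the
variables that no trace polynomial computes. *)
Lemma ctr_le (n N : nat) (phi : 'I_N -> (nat -> A) -> A) :
  (forall m, multilinear_monom n m ->
     exists c : 'I_N -> F, forall a, tmonom_eval tr a m = \sum_j c j *: phi j a) ->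
  (ctr tr n <= N)%N.
Proof.
move=> span; have [e [Me indep _]] := ctrP tr n.
rewrite leqNgt; apply/negP => /mulmx_kernel ker.
have sp i : exists c : 'I_N -> F, forall a,
    freetr_eval tr a (e i) = \sum_j c j *: phi j a.
  have /choice[c cP] : forall m : tmonom, exists c : 'I_N -> F, m \in msupp (e i) ->
      forall a, tmonom_eval tr a m = \sum_j c j *: phi j a.
    move=> m; have [mi|mi] := boolP (m \in msupp (e i)); last by exists (fun=> 0).
    by have [c cP] := span m (Me i m mi); exists c.
  exists (fun j => \sum_(m <- msupp (e i)) (e i)@_m * c m j) => a.
  rewrite /freetr_eval mmapE.
  under [RHS]eq_bigr do rewrite scaler_suml.
  rewrite exchange_big /=; apply: eq_big_seq => m mi.
  rewrite cP // mulr_algl scaler_sumr.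
  by apply: eq_bigr => j _; rewrite scalerA.
have [C CP] := choice sp.
have [u /negP u0 uC] := ker (\matrix_(i, j) C i j).
apply: u0; apply/eqP/rowP => i; rewrite mxE.
apply: (indep (fun i => u 0 i)) => a; rewrite freetr_eval_sum.
under eq_bigr do rewrite CP scaler_sumr.
rewrite exchange_big big1 // => j _.
under eq_bigr do rewrite scalerA.
rewrite -scaler_suml; move/rowP/(_ j): uC; rewrite !mxE.
by under eq_bigr do rewrite mxE; move=> ->; rewrite scale0r.
Qed.

Lemma ctr_ge (n : nat) (T : eqType) (r : seq T) (mon : T -> tmonom) : uniq r ->
  (forall s, s \in r -> multilinear_monom n (mon s)) ->
  (forall c : T -> F,
     (forall a, \sum_(s <- r) c s *: tmonom_eval tr a (mon s) = 0) ->
     forall s, s \in r -> c s = 0) ->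
  (size r <= ctr tr n)%N.
Proof.
move=> ur ml indep; have [e [_ _ span]] := ctrP tr n.
rewrite leqNgt; apply/negP => /mulmx_kernel ker.
pose b (j : 'I_(size r)) := mon (tnth (in_tuple r) j).
have /choice[C CP] : forall j, exists c : 'I_(ctr tr n) -> F,
    forall a, tmonom_eval tr a (b j) = \sum_i c i *: freetr_eval tr a (e i).
  move=> j; have [m|c cP] := span << b j >>.
    by rewrite msuppU1 inE => /eqP ->; apply: ml; rewrite /b mem_tnth.
  exists c => a; apply/eqP; rewrite -subr_eq0 -freetr_evalU -freetr_eval_sum -(cP a).
  by rewrite /freetr_eval mmapB.
have [u /negP u0 uC] := ker (\matrix_(i, j) C i j).
apply: u0; apply/eqP/rowP => j; rewrite mxE.
pose c s := if insub (index s r) is Some j then u 0 j else 0.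
have cE i : c (tnth (in_tuple r) i) = u 0 i.
  by rewrite /c (tnth_nth (tnth (in_tuple r) i)) index_uniq // valK.
rewrite -cE; apply: (indep c) => [a|]; last exact: (mem_tnth j (in_tuple r)).
rewrite big_tnth.
under eq_bigr do rewrite cE CP scaler_sumr.
rewrite exchange_big big1 // => i _.
under eq_bigr do rewrite scalerA.
rewrite -scaler_suml; move/rowP/(_ i): uC; rewrite !mxE.
by under eq_bigr do rewrite mxE; move=> ->; rewrite scale0r.
Qed.

Definition letter (i : nat) : tmonom := (FMonom [:: i], mone).
Definition word1 (i : nat) : nzword := exist _ [:: i] isT.
Definition trletter (i : nat) : tmonom := (mone, ucm (\pi_cycword (word1 i))).

Lemma tmonom_evalM a m m' :
  tmonom_eval tr a (mmul m m') = tmonom_eval tr a m * tmonom_eval tr a m'.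
Proof. by have [-> _] := tmonom_eval_is_mmorphism tr a. Qed.

Lemma tmonom_eval_letter a i : tmonom_eval tr a (letter i) = a i.
Proof.
by rewrite /tmonom_eval /word_eval mdom1 big_seq_fset0 big_seq1 scale1r.
Qed.

Lemma tmonom_eval_trletter a i : tmonom_eval tr a (trletter i) = (tr (a i))%:A.
Proof.
rewrite /tmonom_eval /word_eval mdomU big_seq_fset1 cmUU expr1 fm1 big_nil.
by rewrite cyc_eval_pi // /word_eval big_seq1.
Qed.

Lemma degxM j m m' : degx j (mmul m m') = (degx j m + degx j m')%N.
Proof.
rewrite /degx /= fmM count_cat mdomD addnACA; congr (_ + _)%N.
have ext (t : {cmonom cycword}) (E : {fset cycword}) : (finsupp t `<=` E)%fset ->
    (\sum_(c <- finsupp t) t c * cyc_count j c = \sum_(c <- E) t c * cyc_count j c)%N.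
  move=> le; rewrite (big_fset_incl _ le) // => c _.
  by rewrite -cmE_neq0 negbK => /eqP->.
rewrite (ext m.2 _ (fsubsetUl _ (finsupp m'.2))) (ext m'.2 _ (fsubsetUr (finsupp m.2) _)).
by rewrite -big_split; apply: eq_bigr => c _; rewrite cmM mulnDl.
Qed.

Lemma degx_letter j i : degx j (letter i) = (i == j).
Proof. by rewrite /degx /= mdom1 big_seq_fset0 !addn0. Qed.

Lemma degx_trletter j i : degx j (trletter i) = (i == j).
Proof.
rewrite /degx /= fm1 mdomU big_seq_fset1 cmUU mul1n /cyc_count.
case: piP => v /eqmodP /cyc_relP[M [N [MN ->]]].
by rewrite add0n count_cat addnC -count_cat -MN /= addn0.
Qed.
End Monomials.

(** * Exponential growth *)

(** Listing the bit sequences recursively, rather than as tuples, lets a sum over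
them split along the first bit. *)
Fixpoint bits (n : nat) : seq bitseq :=
  if n is n'.+1 then map (cons true) (bits n') ++ map (cons false) (bits n')
  else [:: [::]].

Lemma size_bits n : size (bits n) = (2 ^ n)%N.
Proof.
by elim: n => //= n IHn; rewrite size_cat !size_map IHn addnn -mul2n expnS.
Qed.

Lemma mem_bits n s : (s \in bits n) = (size s == n).
Proof.
elim: n s => [|n IHn] s /=; first by rewrite inE -size_eq0.
rewrite mem_cat; case: s => [|b s].
  by apply/negbTE/norP; split; apply/mapP => -[].
have m b' : (b :: s \in map (cons b') (bits n)) = (b == b') && (size s == n).
  apply/mapP/andP => [[s' s'n [-> ->]]|[/eqP <- sn]]; first by rewrite -IHn s'n.
  by exists s; rewrite ?IHn.
by rewrite !m /= eqSS; case: b {m}; rewrite ?orbF.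
Qed.

Lemma bits_uniq n : uniq (bits n).
Proof.
elim: n => //= n IHn; have inj b : injective (cons b : bitseq -> bitseq).
  by move=> s t [].
rewrite cat_uniq !map_inj_uniq ?IHn //= andbT.
by apply/hasPn => _ /mapP[s _ ->]; apply/mapP => -[].
Qed.

Section BitWords.
Variables (F : fieldType) (V : lmodType F) (op : bool -> bool -> V -> V).
Hypothesis op_linear : forall b c k u v, op b c (k *: u + v) = k *: op b c u + op b c v.
Hypothesis opC : forall b c b' c' v, op b c (op b' c' v) = op b' c' (op b c v).

(** The determinant of the 2 by 2 array of commuting operators [op]. *)
Definition opdet v := op true false (op false true v) - op true true (op false false v).

(** The head of [s] carries the highest index, so that the tail of [s] uses the
values of [t] up to its own length. *)
Fixpoint opword (t : nat -> bool) (s : bitseq) (v : V) :=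
  if s is b :: s' then op b (t (size s').+1) (opword t s' v) else v.

Lemma op0 b c : op b c 0 = 0.
Proof. by have := op_linear b c (-1) 0 0; rewrite scaler0 addr0 scaleN1r addNr. Qed.

Lemma opD b c u v : op b c (u + v) = op b c u + op b c v.
Proof. by have := op_linear b c 1 u v; rewrite !scale1r. Qed.

Lemma opZ b c k v : op b c (k *: v) = k *: op b c v.
Proof. by have := op_linear b c k v 0; rewrite op0 !addr0. Qed.

Lemma opN b c v : op b c (- v) = - op b c v.
Proof. by rewrite -scaleN1r opZ scaleN1r. Qed.

Lemma op_opdet b c v : op b c (opdet v) = opdet (op b c v).
Proof. by rewrite /opdet opD opN !(opC b c). Qed.

Lemma iter_opdet_op b c k v : iter k opdet (op b c v) = op b c (iter k opdet v).
Proof. by elim: k => //= k ->; rewrite op_opdet. Qed.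

(** Cramer's rule. *)
Lemma opdet_kernel u v : (forall c, op true c u + op false c v = 0) ->
  opdet u = 0 /\ opdet v = 0.
Proof.
move=> H; have Hc c : op true c u = - op false c v.
  by apply/eqP; rewrite -addr_eq0 H.
have Hv c : op false c v = - op true c u by rewrite Hc opprK.
split; rewrite /opdet.
  by rewrite (opC true false) (opC true true) !Hc !opN (opC false false) subrr.
by rewrite !Hv !opN (opC true false) subrr.
Qed.

Lemma opword_ext t t' s v : (forall i, (i <= size s)%N -> t i = t' i) ->
  opword t s v = opword t' s v.
Proof.
elim: s => //= b s IHs tt'; rewrite tt' // IHs // => i le; apply: tt'.
exact: leqW.
Qed.

(** Varying the value of [t] that goes with the first bit gives a 2 by 2 system
whose unknowns are the sums over the two possible first bits; by Cramer's rule,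
both are killed by one more application of [opdet]. *)
Lemma opwords_indep n k (c : bitseq -> F) y :
  (forall t, iter k opdet (\sum_(s <- bits n) c s *: opword t s y) = 0) ->
  iter (k + n) opdet y != 0 -> forall s, s \in bits n -> c s = 0.
Proof.
have detZ a v : opdet (a *: v) = a *: opdet v by rewrite /opdet !opZ scalerBr.
have iterZ j a v : iter j opdet (a *: v) = a *: iter j opdet v.
  by elim: j => //= j ->; rewrite detZ.
have detD u v : opdet (u + v) = opdet u + opdet v.
  by rewrite /opdet !opD opprD addrACA.
have iterD j u v : iter j opdet (u + v) = iter j opdet u + iter j opdet v.
  by elim: j => //= j ->; rewrite detD.
elim: n k c => [|n IHn] k c H y0 s sn.
  move: (H (fun=> true)) sn; rewrite /= big_seq1 iterZ => /eqP.
  rewrite scaler_eq0 inE; move: y0; rewrite addn0 => /negbTE -> /orP[/eqP c0|//].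
  by move/eqP ->.
pose S b t := \sum_(s <- bits n) c (b :: s) *: opword t s y.
have det0 t : opdet (iter k opdet (S true t)) = 0 /\ opdet (iter k opdet (S false t)) = 0.
  apply: opdet_kernel => d.
  pose t' i := if i == n.+1 then d else t i.
  rewrite -!iter_opdet_op -iterD -[RHS](H t'); congr (iter _ _ _).
  rewrite /= big_cat !big_map /=.
  have sumE b : op b d (S b t) =
      \sum_(s <- bits n) c (b :: s) *: op b (t' (size s).+1) (opword t' s y).
    rewrite /S (big_morph (op b d) (opD b d) (op0 b d)).
    apply: eq_big_seq => u; rewrite mem_bits => /eqP su.
    rewrite opZ su /t' eqxx; congr (_ *: op _ _ _); apply: opword_ext => i.
    by rewrite su => le; rewrite ltn_eqF.
  by rewrite !sumE.
move: sn; rewrite mem_bits; case: s => // b s /eqP[sn].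
apply: (IHn k.+1 (fun s => c (b :: s))); last by rewrite mem_bits sn.
  by move=> t; rewrite iterS; have [] := det0 t; case: b.
by rewrite addSnnS.
Qed.
End BitWords.

Section ExponentialGrowth.
Variables (R : realType) (F : fieldType) (A : falgType F) (tr : {scalar A}).

(** The monomials are built from the letter [x_0] by successive insertions [mon],
and a letter acts by [op b 1] or [op b x] according to the value that it is
given.  The value [y] of [x_0] may depend on the degree. *)
Lemma exp_growth_of_op (x : A) (op : bool -> A -> A -> A)
    (mon : bool -> nat -> tmonom -> tmonom) :
  (forall b i m j, degx j (mon b i m) = ((i == j) + degx j m)%N) ->
  (forall b i m a, tmonom_eval tr a (mon b i m) = op b (a i) (tmonom_eval tr a m)) ->
  (forall b c k u v, op b c (k *: u + v) = k *: op b c u + op b c v) ->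
  (forall b c b' c' v, c \in [:: 1; x] -> c' \in [:: 1; x] ->
     op b c (op b' c' v) = op b' c' (op b c v)) ->
  (forall n, exists y,
     iter n (fun v => op true 1 (op false x v) - op true x (op false 1 v)) y != 0) ->
  exp_growth R (ctr tr).
Proof.
move=> monD monE opL opC detN.
have lower n : (2 ^ n <= ctr tr n.+1)%N.
  pose op' b (c : bool) := op b (if c then x else 1).
  have op'L b c k u v : op' b c (k *: u + v) = k *: op' b c u + op' b c v by apply: opL.
  have op'C b c b' c' v : op' b c (op' b' c' v) = op' b' c' (op' b c v).
    by apply: opC; case: ifP; rewrite !inE eqxx ?orbT.
  pose fix M (s : bitseq) := if s is b :: s' then mon b (size s').+1 (M s') else letter 0.
  rewrite -size_bits; apply: (@ctr_ge _ _ _ _ _ (bits n) M); first exact: bits_uniq.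
    move=> s; rewrite mem_bits => /eqP <- j.
    elim: s => [|b s IHs] /=; first by rewrite degx_letter; case: j.
    rewrite monD IHs; lia.
  move=> c cM; have [y yn] := detN n.
  apply: (opwords_indep op'L op'C (k := 0%N) (y := y)) => [t|]; last exact: yn.
  rewrite /= -[RHS](cM (fun i => if i is 0%N then y else if t i then x else 1)).
  apply: eq_bigr => s _; congr (_ *: _).
  by elim: s => [|b s IHs] /=; rewrite ?tmonom_eval_letter // monE IHs.
(* One of the [n] letters is [x_0], hence the factor 1/2. *)
exists (2^-1), 2; split; rewrite ?invr_gt0 ?ltr1n ?ltr0n // => -[//|n] _.
rewrite exprS mulrA mulVf ?mul1r ?pnatr_eq0 //.
by rewrite -natrX ler_nat.
Qed.

Lemma not_engel_exp_growth : ~ engel A -> exp_growth R (ctr tr).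
Proof.
move=> /existsNP[x /forallNP xn].
apply: (@exp_growth_of_op x (fun b c v => if b then v * c else c * v)
  (fun b i m => if b then mmul m (letter i) else mmul (letter i) m)).
- by case=> i m j; rewrite degxM degx_letter // addnC.
- by case=> i m a; rewrite tmonom_evalM tmonom_eval_letter.
- by case=> c k u v; rewrite ?mulrDl ?mulrDr -?scalerAl -?scalerAr.
- have xC c c' : c \in [:: 1; x] -> c' \in [:: 1; x] -> c * c' = c' * c.
    by rewrite !inE => /pred2P[] -> /pred2P[] ->; rewrite ?mulr1 ?mul1r.
  move=> [] c [] c' v cx c'x; rewrite ?mulrA //.
    by rewrite -!mulrA (xC c).
  by rewrite (xC c).
- move=> n; have /existsNP[y yn] := xn n; exists y; apply/eqP.
  have E : (fun v => x * v * 1 - 1 * v * x) =1 ad x.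
    by move=> v; rewrite mulr1 mul1r.
  by rewrite (eq_iter E).
Qed.

Hypothesis trC : is_trace tr.

Lemma trace_exp_growth x : ~ nilp (tr 1 *: x - (tr x)%:A) -> exp_growth R (ctr tr).
Proof.
move=> nx.
apply: (@exp_growth_of_op x (fun b c v => (if b then (tr c)%:A else c) * v)
  (fun b i m => mmul (if b then trletter i else letter i) m)).
- by case=> i m j; rewrite degxM ?degx_letter ?degx_trletter.
- by case=> i m a; rewrite tmonom_evalM ?tmonom_eval_letter ?tmonom_eval_trletter.
- by move=> b c k u v; rewrite mulrDr -scalerAr.
- move=> b c b' c' v cx c'x; rewrite !mulrA; congr (_ * _).
  have scC (k : F) (u : A) : k%:A * u = u * k%:A by rewrite mulr_algl mulr_algr.
  case: b; first by rewrite scC.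
  case: b'; first by rewrite scC.
  by move: cx c'x; rewrite !inE => /pred2P[] -> /pred2P[] ->; rewrite ?mulr1 ?mul1r.
- move=> n; exists 1; apply: contra_notN nx => /eqP n0; exists n.
  rewrite -n0; elim: {n0} n => [|n IHn] //=; rewrite -IHn exprS.
  by rewrite mul1r [X in _ = X - _]mulrA -mulrBl mulr_algl.
Qed.
End ExponentialGrowth.

(** * Polynomial growth *)

Section PolynomialGrowth.
Variables (R : realType) (F : fieldType) (A : falgType F) (tr : {scalar A}).

Definition in_span (N : nat) (phi : 'I_N -> (nat -> A) -> A) (f : (nat -> A) -> A) :=
  exists c : 'I_N -> F, forall a, f a = \sum_j c j *: phi j a.

Lemma in_span0 N (phi : 'I_N -> (nat -> A) -> A) : in_span phi (fun=> 0).
Proof. by exists (fun=> 0) => a; rewrite big1 // => j _; rewrite scale0r. Qed.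

Lemma in_span_gen N (phi : 'I_N -> (nat -> A) -> A) j : in_span phi (phi j).
Proof.
exists (fun i => (i == j)%:R) => a; rewrite (bigD1 j) //= eqxx scale1r.
by rewrite big1 ?addr0 // => i /negbTE ->; rewrite scale0r.
Qed.

Lemma in_spanD N (phi : 'I_N -> (nat -> A) -> A) f g :
  in_span phi f -> in_span phi g -> in_span phi (fun a => f a + g a).
Proof.
move=> [c cE] [d dE]; exists (fun i => c i + d i) => a.
by rewrite cE dE -big_split; apply: eq_bigr => j _; rewrite scalerDl.
Qed.

Lemma in_spanZ N (phi : 'I_N -> (nat -> A) -> A) k f :
  in_span phi f -> in_span phi (fun a => k *: f a).
Proof.
move=> [c cE]; exists (fun i => k * c i) => a.
by rewrite cE scaler_sumr; apply: eq_bigr => j _; rewrite scalerA.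
Qed.

Lemma prod_central_perm (f : nat -> A) s s' : (forall i b, f i * b = b * f i) ->
  perm_eq s s' -> \prod_(i <- s) f i = \prod_(i <- s') f i.
Proof.
move=> fC ss'.
have fsC u b : (\prod_(i <- u) f i) * b = b * \prod_(i <- u) f i.
  elim: u => [|i u IHu]; first by rewrite big_nil mul1r mulr1.
  by rewrite big_cons -mulrA IHu mulrA fC mulrA.
pose P u := \prod_(i <- s) f i = \prod_(i <- u) f i.
apply: (@catCA_perm_ind _ P) ss' _ => // s1 s2 s3.
by rewrite /P !big_cat /= !mulrA (fsC s1).
Qed.

(** The words of length at most [m] in [n] letters, encoded by tuples with blanks
so that their number is bounded by [n.+1 ^ m]. *)
Definition tuple_word n m (t : m.-tuple (option 'I_n)) : seq nat :=
  pmap (omap (@nat_of_ord n)) t.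

Lemma tuple_wordP n m (u : seq nat) : (size u <= m)%N -> {in u, forall i, i < n}%N ->
  exists t : m.-tuple (option 'I_n), tuple_word t = u.
Proof.
move=> um un; pose s : seq (option 'I_n) := map insub u ++ nseq (m - size u) None.
have sz : size s == m by rewrite size_cat size_map size_nseq subnKC.
exists (Tuple sz); rewrite /tuple_word /= /s pmap_cat.
have -> k : pmap (omap (@nat_of_ord n)) (nseq k None) = [::] by elim: k.
rewrite cats0; elim: u un {um s sz} => //= i u IHu iu.
have lt : (i < n)%N by apply: iu; rewrite mem_head.
by rewrite insubT /= IHu // => j ju; apply: iu; rewrite inE ju orbT.
Qed.

Variables (p : A -> A) (t : F) (m : nat).
Hypothesis pC : forall x b, p x * b = b * p x.
Hypothesis tr_word : forall a w, (tr (word_eval a w))%:A = t *: \prod_(i <- w) p (a i).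
Let q x := x - p x.
Hypothesis q_nil : forall s : seq A, (m < size s)%N -> \prod_(x <- s) q x = 0.

Section FixedDegree.
Variable n : nat.
Let J : finType := m.-tuple (option 'I_n).

Definition split_monom (u : seq nat) (a : nat -> A) : A :=
  \prod_(i <- iota 0 n | i \notin u) p (a i) * \prod_(i <- u) q (a i).

Let phi (j : 'I_#|J|) := split_monom (tuple_word (enum_val j)).

(** The word [w] is what remains to be expanded: its first letter is the sum of
its [p] part, which moves to [v], and of its [q] part, which joins [u]. *)
Lemma in_span_expand w v u : perm_eq (v ++ u ++ w) (iota 0 n) ->
  in_span phi (fun a => \prod_(i <- v) p (a i) * \prod_(i <- u) q (a i)
                        * \prod_(i <- w) a i).
Proof.
elim: w v u => [|i w IHw] v u vuw; last first.
  have E a : \prod_(j <- v) p (a j) * \prod_(j <- u) q (a j) * \prod_(j <- i :: w) a j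
     = \prod_(j <- i :: v) p (a j) * \prod_(j <- u) q (a j) * \prod_(j <- w) a j
     + \prod_(j <- v) p (a j) * \prod_(j <- rcons u i) q (a j) * \prod_(j <- w) a j.
    rewrite !big_cons -cats1 big_cat /= big_seq1 -[X in _ * (X * _)](subrK (p (a i))) -/(q _).
    rewrite [_ + p _]addrC mulrDl mulrDr; congr (_ + _); rewrite !mulrA //.
    by congr (_ * _); rewrite -pC !mulrA.
  have vi : perm_eq ((i :: v) ++ u ++ w) (iota 0 n).
    by apply: perm_trans vuw; apply/permP => P; rewrite /= !count_cat /=; lia.
  have ui : perm_eq (v ++ rcons u i ++ w) (iota 0 n).
    by apply: perm_trans vuw; rewrite cat_rcons.
  have [c cE] := in_spanD (IHw _ _ vi) (IHw _ _ ui).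
  by exists c => a; rewrite E cE.
move: vuw; rewrite cats0 => vu.
have [lt|le] := ltnP m (size u).
  have [c cE] := in_span0 phi; exists c => a; rewrite -cE.
  by rewrite -(big_map a xpredT q) q_nil ?size_map // mulr0 mul0r.
have [|j jE] := @tuple_wordP n m u le.
  by move=> i iu; have := perm_mem vu i; rewrite mem_cat iu orbT mem_iota.
have [c cE] := in_span_gen phi (enum_rank j); exists c => a.
rewrite -cE /phi enum_rankK jE big_nil mulr1 /split_monom; congr (_ * _).
rewrite -[RHS]big_filter; apply: prod_central_perm; first by move=> *; apply: pC.
have := perm_filter (fun i => i \notin u) vu; rewrite filter_cat.
have : uniq (v ++ u) by rewrite (perm_uniq vu) iota_uniq.
rewrite cat_uniq => /and3P[_ /hasPn/= vu0 _].
rewrite (eq_in_filter (a2 := xpredT)) ?filter_predT; last first.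
  by move=> i iv; apply/negP => /vu0; rewrite iv.
rewrite [X in v ++ X](eq_in_filter (a2 := pred0)) ?filter_pred0 ?cats0 //.
by move=> i iu; rewrite /= iu.
Qed.

Definition trace_letters (s : {cmonom cycword}) (r : seq cycword) : seq nat :=
  flatten [seq flatten (nseq (s c) (val (repr c))) | c <- r].

(** The traces in a monomial turn into letters evaluated by [p], up to a power of
[t]. *)
Lemma trace_factor a (s : {cmonom cycword}) (r : seq cycword) :
  (\prod_(c <- r) cyc_eval tr a c ^+ s c)%:A
  = t ^+ (\sum_(c <- r) s c) *: \prod_(i <- trace_letters s r) p (a i).
Proof.
have one c k : (cyc_eval tr a c ^+ k)%:A
    = t ^+ k *: \prod_(i <- flatten (nseq k (val (repr c)))) p (a i).
  elim: k => [|k IHk]; first by rewrite big_nil.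
  rewrite exprS /= big_cat /= -scalerA IHk -[X in _ *: X]mul1r scalerAl tr_word.
  by rewrite -scalerAl -scalerAr scalerA -exprS.
rewrite /trace_letters; elim: r => [|c r IHr]; first by rewrite !big_nil.
rewrite !big_cons /= big_cat /= -scalerA IHr -[X in _ *: X]mul1r scalerAl one.
by rewrite -scalerAl -scalerAr scalerA -exprD.
Qed.

Lemma ctr_le_split : (ctr tr n <= n.+1 ^ m)%N.
Proof.
have -> : (n.+1 ^ m)%N = #|J| by rewrite card_tuple card_option card_ord.
apply: (@ctr_le _ _ _ _ _ phi) => -[w s] ml.
have perm : perm_eq (trace_letters s (finsupp s) ++ [::] ++ w) (iota 0 n).
  apply/allP => j _ /=; rewrite count_cat (count_uniq_mem _ (iota_uniq 0 n)) mem_iota.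
  rewrite add0n /= -(ml j) /degx /= addnC; apply/eqP; congr (_ + _)%N.
  rewrite count_flatten sumnE !big_map; apply: eq_bigr => c _.
  by rewrite count_flatten map_nseq sumn_nseq mulnC.
have [c cE] := in_spanZ (t ^+ (\sum_(c <- finsupp s) s c)) (in_span_expand perm).
exists c => a; rewrite -cE big_nil mulr1 scalerAl -trace_factor mulr_algl.
by [].
Qed.
End FixedDegree.

Lemma poly_bounded_split : poly_bounded R (ctr tr).
Proof.
exists (('X + 1) ^+ m) => n _; rewrite horner_exp !hornerE natr1 -natrX.
by rewrite ler_nat ctr_le_split.
Qed.
End PolynomialGrowth.

Section Dichotomy.
Variables (R : realType) (F : fieldType) (A : falgType F) (tr : {scalar A}).
Hypothesis engA : engel A.

Lemma nilp_scalar (k : F) : nilp (k%:A : A) -> k = 0.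
Proof.
case=> n; have -> : (k%:A : A) ^+ n = (k ^+ n)%:A by rewrite exprZn expr1n.
by move/eqP; rewrite scaler_eq0 oner_eq0 orbF expf_eq0 => /andP[_ /eqP].
Qed.

Lemma traceless_poly_bounded : [pchar F] =i pred0 -> (forall x, tr x = 0) ->
  poly_bounded R (ctr tr).
Proof.
move=> charF tr0.
have /choice[p pP] : forall a : A, exists s : A, nilp (a - s) /\ forall b, s * b = b * s.
  by move=> a; have [s ns sC] := engel_central_part charF a engA; exists s.
have [m mP] := engel_nilpotent engA.
apply: (@poly_bounded_split R F A tr p 0 m) => [x b|a w|s ms].
- by have [_] := pP x.
- by rewrite tr0 !scale0r.
- rewrite -(big_map (fun x => x - p x) xpredT id) mP ?size_map //.
  by move=> _ /mapP[x _ ->]; have [] := pP x.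
Qed.

(** Since [x - e x] is nilpotent for [e := tr / tr 1], the scalar
[e (x * y) - e x * e y] is a combination of elements of the ideal of nilpotent
elements, hence zero. *)
Lemma multiplicative_trace_poly_bounded : tr 1 != 0 ->
  (forall x, nilp (tr 1 *: x - (tr x)%:A)) -> poly_bounded R (ctr tr).
Proof.
move=> t0 trn; pose e x := tr x / tr 1.
have en x : nilp (x - (e x)%:A).
  have := nilpZ (tr 1)^-1 (trn x).
  by rewrite scalerBr !scalerA mulVf // scale1r mulrC.
have eM x y : e (x * y) = e x * e y.
  apply/eqP; rewrite -subr_eq0; apply/eqP/nilp_scalar.
  have -> : (e (x * y) - e x * e y)%:A
      = ((x - (e x)%:A) * y + e x *: (y - (e y)%:A)) + (-1) *: (x * y - (e (x * y))%:A).
    have telescope (a b c d : A) : a - b + (b - c) + (d - a) = d - c.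
      by rewrite subrKA addrC subrKA.
    by rewrite mulrBl mulr_algl scalerBr scaleN1r opprB scalerA telescope scalerBl.
  apply: engel_nilpD => //; last exact: nilpZ.
  apply: engel_nilpD => //; last exact: nilpZ.
  exact: engel_nilpMr.
have [m mP] := engel_nilpotent engA.
apply: (@poly_bounded_split R F A tr (fun x => (e x)%:A) (tr 1) m) => [x b|a w|s ms].
- by rewrite mulr_algl mulr_algr.
- have trE x : tr x = tr 1 * e x by rewrite mulrCA mulfV ?mulr1.
  rewrite trE -scalerA; congr (_ *: _); rewrite /word_eval.
  elim: w => [|i w IHw]; first by rewrite !big_nil /e mulfV // scale1r.
  by rewrite !big_cons eM -scalerA IHw mulr_algl.
- rewrite -(big_map (fun x => x - (e x)%:A) xpredT id) mP ?size_map //.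
  by move=> _ /mapP[x _ ->].
Qed.
End Dichotomy.

Theorem corollary31 (R : realType) (F : fieldType) (charF : [pchar F] =i pred0)
    (A : falgType F) (tr : {scalar A}) (trC : is_trace tr) :
  poly_bounded R (ctr tr) \/ exp_growth R (ctr tr).
Proof.
have [engA|nengA] := pselect (engel A); last by right; apply: not_engel_exp_growth.
have [trn|/existsNP[x nx]] :=
  pselect (forall x, nilp (tr 1 *: x - (tr x)%:A)); last first.
  by right; apply: trace_exp_growth nx.
left; have [t0|t0] := eqVneq (tr 1) 0; last exact: multiplicative_trace_poly_bounded.
apply: traceless_poly_bounded => // x; apply/oppr_inj; rewrite oppr0.
by apply: (@nilp_scalar _ A); have := trn x; rewrite t0 scale0r sub0r scaleNr.
Qed.
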